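(* Let $M$ be an oriented $3$-valent map. Then: (i) for corners $c,c',c''$ at a common vertex, $sh(c,c'')\equiv sh(c,c')+sh(c',c'')\pmod 3$; (ii) for any function $\phi:V(M)\to Corner(M)$ such that $\phi(v)$ is a corner at $v$ for every $v$, and any $f\in OrMap(M)$, the residue $\sum_{v\in V(M)} sh\big(f(\phi(v)),\phi(f(v))\big)\pmod 3$ does not depend on $\phi$; denote it $sh(f)\in\mathbb{Z}_3$; (iii) for $f,g\in OrMap(M)$, $sh(f\circ g)\equiv sh(f)+sh(g)\pmod 3$; (iv) $sh$ is not identically $0$ on $OrMap(M)$; (v) every $f\in Rubik(M)$ (acting on corners) satisfies $sh(f)\equiv 0\pmod 3$.
   Context: A $3$-valent map $M$ is a cellularly embedded $3$-regular graph on a surface; $V(M)$, $E(M)$, $Face(M)$ denote its vertices, edges and faces. Throughout, every face boundary is a simple cycle, every edge lies in two distinct faces, and the three faces at any vertex are pairwise distinct. A corner is a pair $(F,v)$ with $v$ a vertex of the face $F$; $Corner(M)$ is the set of corners, and each vertex $v$ lies in exactly three corners $C_v$. Side movement: let $F$ have boundary cycle $v_1,\dots,v_p$ (indices mod $p$, in a chosen direction), edges $e_i=v_iv_{i+1}$, and let $G_i$ be the face other than $F$containing $e_i$. The side movement $sm(M,F)$ permutes corners by $(F,v_i)\mapsto(F,v_{i+1})$, $(G_{i-1},v_i)\mapsto(G_i,v_{i+1})$, $(G_i,v_i)\mapsto(G_{i+1},v_{i+1})$, fixing all other corners (it also permutes side edges $(F,e_i)\mapsto(F,e_{i+1})$,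 $(G_i,e_i)\mapsto(G_{i+1},e_{i+1})$). $Rubik(M)$ is the group generated by all $sm(M,F)$, $F\in Face(M)$. When $M$ is oriented, the orientation gives a cyclic (''direct'') order on each $C_v$; let $r$ be the rotation of $C_v$ advancing one step in this order. $OrMap(M)$ is the set of permutations of $Corner(M)$ that map each triple $C_v$ onto some triple $C_{v'}$ preserving the cyclic orders (such $f$ induces a permutation $v\mapsto f(v)$ of $V(M)$). For corners $c,c'$ at the same vertex, $sh(c,c')$ is the $k\in\{0,1,2\}$ with $r^k(c)=c'$. *)

(* Defs.v *)
From HB Require Import structures.
From mathcomp Require Import all_boot all_order all_algebra all_fingroup.

Set Implicit Arguments.
Unset Strict Implicit.
Unset Printing Implicit Defensive.

Import GRing.Theory.

(** A finite map on a closed oriented surface, given by its rotation system.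
    A dart is an edge with a choice of one of its two ends; [drot] turns a dart
    to the next one around its origin in the direct sense, and [dopp] exchanges
    the two darts of an edge.  Vertices and edges are the orbits of [drot] and
    [dopp].  The face lying to the left of a dart [d] is the orbit of [d] under
    [fperm], which maps [d] to [drot^-1 (dopp d)] ([*] on permutations composes
    from left to right): walk along [d], then leave the vertex reached by the
    dart having the same face on its left. *)
Record oriented_map := OrientedMap {
  dart : finType;
  drot : {perm dart};
  dopp : {perm dart};
  dart_gt0 : 0 < #|dart|;
  dopp_neq : forall d, dopp d != d;
  doppK : forall d, dopp (dopp d) = d
}.

Definition fperm (M : oriented_map) : {perm dart M} := (dopp M * (drot M)^-1)%g.

Definition vertex (M : oriented_map) :=
  {v : {set dart M} | v \in porbits (drot M)}.
Definition edge (M : oriented_map) :=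
  {e : {set dart M} | e \in porbits (dopp M)}.
Definition face (M : oriented_map) :=
  {F : {set dart M} | F \in porbits (fperm M)}.

Section Incidence.
Variable M : oriented_map.
Implicit Type d : dart M.

Definition vtx d : vertex M := exist (fun v => v \in porbits (drot M)) _
  (imset_f (porbit (drot M)) (isT : d \in dart M)).
Definition edg d : edge M := exist (fun e => e \in porbits (dopp M)) _
  (imset_f (porbit (dopp M)) (isT : d \in dart M)).
Definition fac d : face M := exist (fun F => F \in porbits (fperm M)) _
  (imset_f (porbit (fperm M)) (isT : d \in dart M)).

(** The boundary of [F] meets [v] (resp. [e]) once for every dart of [F]
    having origin [v] (resp. carried by [e]). *)
Definition on_vertex (F : face M) (v : vertex M) := val F :&: val v.
Definition on_edge (F : face M) (e : edge M) := val F :&: val e.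

Definition corner := {c : face M * vertex M | on_vertex c.1 c.2 != set0}.
Definition side_edge := {s : face M * edge M | on_edge s.1 s.2 != set0}.

Definition cface (c : corner) : face M := (val c).1.
Definition cvert (c : corner) : vertex M := (val c).2.
Definition corners_at (v : vertex M) : {set corner} := [set c | cvert c == v].

Lemma on_vertexP d : on_vertex (fac d) (vtx d) != set0.
Proof. by apply/set0Pn; exists d; rewrite inE !porbit_id. Qed.

Definition dcorner d : corner :=
  exist (fun c => on_vertex c.1 c.2 != set0) (fac d, vtx d) (on_vertexP d).

Definition cdart (c : corner) : dart M := xchoose (set0Pn _ (valP c)).

(** The three corners at a vertex in direct order are those of [d], [drot d]
    and [drot (drot d)], the corner of a dart [d] being the sector between [d]
    and [drot d], to the left of [d]. *)
Definition crot (c : corner) : corner := dcorner (drot M (cdart c)).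

Definition sh (c c' : corner) : nat :=
  oapp (@nat_of_ord 3) 0 [pick k : 'I_3 | iter k crot c == c'].

Definition OrMap : {set {perm corner}} :=
  [set f : {perm corner} |
    [forall v, exists v', f @: corners_at v == corners_at v']
    && [forall c, f (crot c) == crot (f c)]].

Definition vact (f : {perm corner}) (v : vertex M) : vertex M :=
  odflt v [pick v' | f @: corners_at v == corners_at v'].

Definition corner_choice (phi : vertex M -> corner) : Prop :=
  forall v, cvert (phi v) = v.

Definition sh_sum (phi : vertex M -> corner) (f : {perm corner}) : 'Z_3 :=
  (\sum_(v : vertex M) (sh (f (phi v)) (phi (vact f v)))%:R)%R.

Lemma vertex_dart (v : vertex M) : exists d, d \in val v.
Proof. by case: v => v /= /imsetP[d _ ->]; exists d; apply: porbit_id. Qed.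

Definition some_corner (v : vertex M) : corner :=
  dcorner (xchoose (vertex_dart v)).

Lemma some_cornerP : corner_choice some_corner.
Proof.
move=> v; rewrite /some_corner; move: (xchooseP (vertex_dart v)).
move: (xchoose _) => d dv; apply: val_inj => /=.
by case: v dv => /= v /imsetP[x _ ->]; rewrite -eq_porbit_mem => /eqP.
Qed.

(** [sh_sum phi f] is independent of the corner choice [phi] when [f] is in
    [OrMap]; any [phi] may be used to define the residue. *)
Definition sh_map (f : {perm corner}) : 'Z_3 := sh_sum some_corner f.

End Incidence.

(** Oriented 3-valent maps under the standing assumptions: face boundaries are
    simple cycles, the two sides of every edge are distinct faces, and the
    three faces at every vertex are distinct. *)
Record cubic_map := CubicMap {
  base_map :> oriented_map;
  cubicP : forall d : dart base_map, #|porbit (drot base_map) d| = 3;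
  face_simple : forall (F : face base_map) v, #|on_vertex F v| <= 1;
  edge_faces : forall d : dart base_map, fac d != fac (dopp base_map d);
  vertex_faces : forall d d' : dart base_map,
    vtx d = vtx d' -> d != d' -> fac d != fac d'
}.

Section SideMovement.
Variable M : cubic_map.
Implicit Types (d x : dart M) (F : face M) (b : bool).

(** Let [F] have boundary v_1, ..., v_p in the direct direction ([b = true],
    [F] on the left) or the opposite one ([b = false]).  If [d] is the dart of
    [F] with origin v_i, then [bnext b d] is the one with origin v_(i+1),
    [along b d] is the dart of [F] carried by e_i = v_i v_(i+1), and
    [across b d] is the face G_i other than [F] containing e_i. *)
Definition bnext b : {perm dart M} := if b then fperm M else (fperm M)^-1%g.
Definition along b d : dart M := if b then d else (fperm M)^-1%g d.
Definition across b d : face M := fac (dopp M (along b d)).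

(** The pairs passed to [insubd] are always incident, so its default is never
    used; likewise the innermost [else] branches are unreachable. *)
Definition sm_corner b F (c : corner M) : corner M :=
  if [pick d in on_vertex F (cvert c)] is Some d then
    let v' := vtx (bnext b d) in
    if cface c == F then insubd c (F, v')
    else if cface c == across b ((bnext b)^-1%g d) then insubd c (across b d, v')
    else if cface c == across b d then insubd c (across b (bnext b d), v')
    else c
  else c.

Definition sm_side b F (s : side_edge M) : side_edge M :=
  if [pick x in on_edge F (val s).2] is Some x then
    let e' := edg (bnext b x) in
    if (val s).1 == F then insubd s (F, e')
    else if (val s).1 == fac (dopp M x) then
      insubd s (fac (dopp M (bnext b x)), e')
    else s
  else s.

Lemma fpermE d : fperm M d = (drot M)^-1%g (dopp M d).
Proof. by rewrite permM. Qed.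

Lemma fpermVE d : (fperm M)^-1%g d = dopp M (drot M d).
Proof. by apply: (@perm_inj _ (fperm M)); rewrite permKV fpermE doppK permK. Qed.

Lemma rot3 d : drot M (drot M (drot M d)) = d.
Proof. by have := iter_porbit (drot M) d; rewrite cubicP. Qed.

Lemma rotVE d : (drot M)^-1%g d = drot M (drot M d).
Proof. by rewrite -{1}[d]rot3 permK. Qed.

Lemma vtx_eq d d' : (vtx d == vtx d') = (d \in porbit (drot M) d').
Proof. by rewrite -eq_porbit_mem. Qed.

Lemma fac_eq d d' : (fac d == fac d') = (d \in porbit (fperm M) d').
Proof. by rewrite -eq_porbit_mem. Qed.

Lemma edg_eq d d' : (edg d == edg d') = (d \in porbit (dopp M) d').
Proof. by rewrite -eq_porbit_mem. Qed.

Lemma face_eq F d : d \in val F -> F = fac d.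
Proof.
case: F => /= F FP dF; apply: val_inj => /=.
case/imsetP: FP dF => x _ ->; rewrite -eq_porbit_mem.
by move/eqP->.
Qed.

Lemma vertex_eq (v : vertex M) d : d \in val v -> v = vtx d.
Proof.
case: v => /= v vP dv; apply: val_inj => /=.
by case/imsetP: vP dv => x _ ->; rewrite -eq_porbit_mem => /eqP->.
Qed.

Lemma edge_eq (e : edge M) d : d \in val e -> e = edg d.
Proof.
case: e => /= e eP de; apply: val_inj => /=.
by case/imsetP: eP de => x _ ->; rewrite -eq_porbit_mem => /eqP->.
Qed.

Lemma vtx_rot d : vtx (drot M d) = vtx d.
Proof. by apply/eqP; rewrite vtx_eq (mem_porbit _ 1). Qed.

Lemma fac_fperm d : fac (fperm M d) = fac d.
Proof. by apply/eqP; rewrite fac_eq (mem_porbit _ 1). Qed.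

Lemma fac_next b d : fac (bnext b d) = fac d.
Proof.
case: b; first exact: fac_fperm.
by rewrite /bnext -[in RHS](permKV (fperm M) d) fac_fperm.
Qed.

Lemma edg_opp d : edg (dopp M d) = edg d.
Proof. by apply/eqP; rewrite edg_eq (mem_porbit _ 1). Qed.

Lemma edgeP d d' : edg d = edg d' -> d' = d \/ d' = dopp M d.
Proof.
move/esym/eqP; rewrite edg_eq => /porbitP[i ->].
elim: i => [|i IH]; first by rewrite perm1; left.
by rewrite expgSr permM; case: IH => ->; [right | left; rewrite doppK].
Qed.

Lemma vertexP d d' : vtx d = vtx d' ->
  [\/ d' = d, d' = drot M d | d' = drot M (drot M d)].
Proof.
move/esym/eqP; rewrite vtx_eq porbit_traject cubicP !inE.
by case/or3P=> /eqP->; [constructor 1 | constructor 2 | constructor 3].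
Qed.

Lemma rot_neq d : (d != drot M d) && (d != drot M (drot M d)).
Proof.
have := uniq_traject_porbit (drot M) d; rewrite cubicP /= !inE !negb_or.
by case/and3P.
Qed.

Lemma dcorner_inj : injective (@dcorner M).
Proof.
move=> d d' E; have Ef : fac d = fac d' by exact: (congr1 (@cface M) E).
have Ev : vtx d = vtx d' by exact: (congr1 (@cvert M) E).
apply/eqP; apply: contraT => ne; have := vertex_faces Ev ne.
by rewrite Ef eqxx.
Qed.

Lemma cdartK : cancel (@cdart M) (@dcorner M).
Proof.
move=> c; apply: val_inj; rewrite /cdart /=.
move: (xchooseP (set0Pn _ (valP c))); move: (xchoose _) => d.
rewrite inE => /andP[dF dv]; rewrite -(face_eq dF) -(vertex_eq dv).
by rewrite -surjective_pairing.
Qed.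

Lemma dcornerK : cancel (@dcorner M) (@cdart M).
Proof. by move=> d; apply: dcorner_inj; rewrite cdartK. Qed.

Lemma pick_vertex F (v : vertex M) d : d \in val F -> d \in val v ->
  [pick x in on_vertex F v] = Some d.
Proof.
move=> dF dv; case: pickP => [x xP|/(_ d)]; last by rewrite inE dF dv.
have dP : d \in on_vertex F v by rewrite inE dF.
by have /card_le1_eqP/(_ x d xP dP)-> := face_simple F v.
Qed.

Lemma pick_edge F d : fac d = F -> [pick x in on_edge F (edg d)] = Some d.
Proof.
move=> <-; case: pickP => [x|/(_ d)]; last by rewrite inE !porbit_id.
rewrite inE => /andP[/face_eq xF /edge_eq/edgeP[-> //| xd]].
by have := edge_faces d; rewrite -xd xF eqxx.
Qed.

Lemma sm_cornerE b F d : fac d = F ->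
  [/\ sm_corner b F (dcorner d) = dcorner (bnext b d),
      sm_corner b F (dcorner (drot M d)) = dcorner (drot M (bnext b d)) &
      sm_corner b F (dcorner (drot M (drot M d)))
        = dcorner (drot M (drot M (bnext b d)))].
Proof.
move=> dF; have dinF : d \in val F by rewrite -dF porbit_id.
have dv : d \in val (vtx d) by exact: porbit_id.
have [n1 n2] := andP (rot_neq d).
have f1 : fac (drot M d) != F.
  by rewrite -dF eq_sym; apply: vertex_faces; rewrite ?vtx_rot.
have f2 : fac (drot M (drot M d)) != F.
  by rewrite -dF eq_sym; apply: vertex_faces; rewrite ?vtx_rot.
have f3 : fac (drot M (drot M d)) == fac (drot M d) = false.
  apply/negbTE; rewrite eq_sym; apply: vertex_faces; first by rewrite !vtx_rot.
  by apply: contra_neq n1 => /perm_inj.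
have R x : fac (dopp M x) = fac (drot M (drot M (x))).
  by rewrite -fac_fperm fpermE doppK rotVE.
have L x : fac (dopp M ((fperm M)^-1%g x)) = fac (drot M x).
  by rewrite fpermVE doppK.
have ins c0 x K : fac x = K -> vtx x = vtx (bnext b d) ->
  insubd c0 (K, vtx (bnext b d)) = dcorner x.
  move=> <- <-; apply: val_inj; rewrite val_insubd /=.
  by rewrite on_vertexP.
rewrite /sm_corner; split.
- rewrite /cvert /cface /= (pick_vertex dinF) // dF eqxx.
  by apply: ins; rewrite // fac_next.
- rewrite /cvert /cface /= vtx_rot (pick_vertex dinF) // (negbTE f1).
  rewrite /across /along; case: b ins => ins.
    rewrite L eqxx; apply: ins; last by rewrite vtx_rot.
    by rewrite fpermE permKV.
  rewrite /bnext invgK permK R eq_sym f3 L eqxx.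
  by apply: ins; rewrite ?vtx_rot // L.
- rewrite /cvert /cface /= !vtx_rot (pick_vertex dinF) // (negbTE f2).
  rewrite /across /along; case: b ins => ins.
    rewrite L f3 R eqxx; apply: ins; last by rewrite !vtx_rot.
    by rewrite R.
  rewrite /bnext invgK permK R eqxx.
  by apply: ins; rewrite ?vtx_rot // R.
Qed.

Lemma sm_corner_off b F c : on_vertex F (cvert c) = set0 -> sm_corner b F c = c.
Proof. by move=> E; rewrite /sm_corner E; case: pickP => // x; rewrite inE. Qed.

Lemma next_negb b d : bnext b (bnext (~~ b) d) = d.
Proof. by case: b; rewrite /= ?permK ?permKV. Qed.

Lemma sm_cornerK b F : cancel (sm_corner (~~ b) F) (sm_corner b F).
Proof.
move=> c; case: (eqVneq (on_vertex F (cvert c)) set0) => [E|/set0Pn[d]].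
  by rewrite !sm_corner_off.
rewrite inE => /andP[dF dv]; have {}dF := esym (face_eq dF).
have [e1 e2 e3] := sm_cornerE (~~ b) dF.
have [g1 g2 g3] := sm_cornerE b (etrans (fac_next (~~ b) d) dF).
rewrite -(cdartK c); have : vtx d = vtx (cdart c).
  by rewrite -(vertex_eq dv) -{1}(cdartK c).
case/vertexP=> ->.
- by rewrite e1 g1 next_negb.
- by rewrite e2 g2 next_negb.
- by rewrite e3 g3 next_negb.
Qed.

Lemma sm_side_off b F s : on_edge F (val s).2 = set0 -> sm_side b F s = s.
Proof. by move=> E; rewrite /sm_side E; case: pickP => // x; rewrite inE. Qed.

Lemma on_edgeP K x : on_edge K (edg x) != set0 -> K = fac x \/ K = fac (dopp M x).
Proof.
case/set0Pn=> y; rewrite inE => /andP[/face_eq -> /edge_eq/edgeP[]->].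
  by left.
by right.
Qed.

Lemma on_edge1 x : on_edge (fac x) (edg x) != set0.
Proof. by apply/set0Pn; exists x; rewrite inE !porbit_id. Qed.

Lemma on_edge2 x : on_edge (fac (dopp M x)) (edg x) != set0.
Proof. by rewrite -edg_opp on_edge1. Qed.

Lemma sm_sideE b F d (s : side_edge M) : fac d = F -> (val s).2 = edg d ->
  val (sm_side b F s) =
    (if (val s).1 == F then F else fac (dopp M (bnext b d)), edg (bnext b d)).
Proof.
move=> dF se; rewrite /sm_side se (pick_edge dF).
have := valP s; rewrite se => /on_edgeP[] E; rewrite E.
  by rewrite dF eqxx val_insubd /= -dF -(fac_next b) on_edge1.
rewrite -dF [_ == fac d]eq_sym (negbTE (edge_faces d)) eqxx.
by rewrite val_insubd /= on_edge2.
Qed.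

Lemma sm_sideK b F : cancel (sm_side (~~ b) F) (sm_side b F).
Proof.
move=> s; case: (eqVneq (on_edge F (val s).2) set0) => [E|/set0Pn[d]].
  by rewrite !sm_side_off.
rewrite inE => /andP[/face_eq/esym dF /edge_eq de].
have E := @sm_sideE (~~ b) F d s dF de; apply: val_inj.
have dF' : fac (bnext (~~ b) d) = F by rewrite fac_next.
rewrite (@sm_sideE b F _ _ dF'); last by rewrite E.
rewrite E /= next_negb.
rewrite [RHS]surjective_pairing de; congr pair.
have := valP s; rewrite de => /on_edgeP[] Es; rewrite Es.
  by rewrite dF !eqxx.
have -> : fac (dopp M d) == F = false.
  by rewrite -dF eq_sym; apply/negbTE/edge_faces.
by rewrite -[X in _ == X]dF' eq_sym (negbTE (edge_faces _)).
Qed.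

Lemma sm_corner_inj b F : injective (sm_corner b F).
Proof. by rewrite -[b]negbK; apply: can_inj (@sm_cornerK (~~ b) F). Qed.

Lemma sm_side_inj b F : injective (sm_side b F).
Proof. by rewrite -[b]negbK; apply: can_inj (@sm_sideK (~~ b) F). Qed.

Definition sm b F : {perm corner M} * {perm side_edge M} :=
  (perm (@sm_corner_inj b F), perm (@sm_side_inj b F)).

(** [dir F] is the direction chosen for the boundary of [F]. *)
Definition Rubik (dir : face M -> bool)
    : {set {perm corner M} * {perm side_edge M}} :=
  <<[set sm (dir F) F | F : face M]>>%g.

End SideMovement.

(* Main.v *)
Require Import Defs.
From mathcomp Require Import all_boot all_order all_algebra all_fingroup.

(** The corners at a vertex form a free orbit of [crot], of order 3, so [sh] is
    the difference cocycle of a Z_3-torsor, and [OrMap M] is the centralizer of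
    [crot].  Additivity of [sh] and reindexing the sum along the vertex
    permutation of [f] give (ii) and (iii).  Turning a single vertex has nonzero
    shift.  For a side movement of [F], take as the chosen corner at each vertex
    of [F] the one belonging to [F]: these choices are carried to each other, so
    every summand vanishes. *)

Import GRing.Theory.

Section SumReindex.
Variables (I : finType) (V : zmodType) (h : I -> I).
Implicit Types A B C D : I -> V.
Hypothesis h_inj : injective h.

Lemma sum_add_reindex A B C : (forall i, A i = B (h i) + C i)%R ->
  (\sum_i A i = \sum_i B i + \sum_i C i)%R.
Proof.
move=> AE; rewrite [X in (X + _)%R](reindex_inj h_inj) /= -big_split.
by apply: eq_bigr => i _; rewrite AE.
Qed.

(** Since [h] is injective on a finite type, [D] and [D \o h] have the same sum, so the [C] and [D]
    parts cancel globally though not termwise. Below, [h] is a vertex permutation and [C], [D]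
    compare two corner choices. *)
Lemma sum_split_reindex A B C D : (forall i, A i = C i + B i + D (h i))%R ->
  (forall i, C i + D i = 0)%R -> (\sum_i A i = \sum_i B i)%R.
Proof.
move=> AE CD; rewrite (@sum_add_reindex A D (fun i => C i + B i)%R).
  by rewrite big_split addrA -big_split /= big1 ?add0r // => i _; rewrite addrC.
by move=> i; rewrite AE addrC.
Qed.

End SumReindex.

Section Shift.
Variable M : cubic_map.
Implicit Types (c : corner M) (v : vertex M) (f g : {perm corner M}).
Implicit Type phi : vertex M -> corner M.

(** * Rotation of the corners at a vertex and the cocycle [sh] *)

Lemma crot_dcorner (d : dart M) : crot (dcorner d) = dcorner (drot M d).
Proof. by rewrite /crot dcornerK. Qed.

Lemma crot3 c : crot (crot (crot c)) = c.
Proof. by rewrite -(cdartK c) !crot_dcorner rot3. Qed.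

Lemma cvert_crot c : cvert (crot c) = cvert c.
Proof. by rewrite -[in RHS](cdartK c) /cvert /= vtx_rot. Qed.

Lemma cvert_iter_crot k c : cvert (iter k (@crot M) c) = cvert c.
Proof. by elim: k => //= k <-; rewrite cvert_crot. Qed.

Lemma crot_inj : injective (@crot M).
Proof. by move=> c c' E; rewrite -(crot3 c) E crot3. Qed.

Lemma iter_crot_mod k c : iter k (@crot M) c = iter (k %% 3) (@crot M) c.
Proof.
rewrite [in LHS](divn_eq k 3) addnC iterD; congr iter.
by elim: (k %/ 3) => // n IHn; rewrite mulSn iterD IHn /= crot3.
Qed.

Lemma crot_neq c : (crot c != c) && (crot (crot c) != c).
Proof.
rewrite -(cdartK c) !crot_dcorner !(inj_eq (@dcorner_inj M)) ![_ == cdart c]eq_sym.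
exact: rot_neq.
Qed.

Lemma sh_iter_crot k c : sh c (iter k (@crot M) c) = k %% 3.
Proof.
rewrite iter_crot_mod; have : k %% 3 < 3 by rewrite ltn_mod.
move: (k %% 3) => {}k lt_k3; rewrite /sh; case: pickP => [i|/(_ (Ordinal lt_k3))] /=.
  have [n1 n2] := andP (crot_neq c).
  have [n3 n4] := andP (crot_neq (crot c)).
  (* The six off-diagonal pairs [(i, k)] remain; each would give [crot] or its square a fixed
     point. *)
  case: i k lt_k3 => [[|[|[|i]]] //= _] [|[|[|k]]] //= _.
  - by rewrite eq_sym (negbTE n1).
  - by rewrite eq_sym (negbTE n2).
  - by rewrite (negbTE n1).
  - by rewrite eq_sym (negbTE n3).
  - by rewrite (negbTE n2).
  - by rewrite (negbTE n3).
by rewrite eqxx.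
Qed.

Lemma same_vertexP c c' :
  cvert c = cvert c' -> exists k, c' = iter k (@crot M) c.
Proof.
rewrite -(cdartK c) -(cdartK c') => /vertexP[] ->.
- by exists 0.
- by exists 1; rewrite /= crot_dcorner.
- by exists 2; rewrite /= !crot_dcorner.
Qed.

Lemma sh_add c c' c'' : cvert c = cvert c' -> cvert c' = cvert c'' ->
  sh c c'' = sh c c' + sh c' c'' %[mod 3].
Proof.
move=> /same_vertexP[k ->] /same_vertexP[l ->].
by rewrite -[in LHS]iterD !sh_iter_crot modn_mod modnDm addnC.
Qed.

Lemma shcc c : sh c c = 0.
Proof. exact: (sh_iter_crot 0). Qed.

Lemma natr_sh_add c c' c'' : cvert c = cvert c' -> cvert c' = cvert c'' ->
  ((sh c c'')%:R = (sh c c')%:R + (sh c' c'')%:R :> 'Z_3)%R.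
Proof.
move=> e e'; rewrite -natrD; apply: val_inj.
by rewrite /= !val_Zp_nat //; apply: sh_add.
Qed.

(** * [OrMap] and its action on vertices *)

Lemma corners_at_inj : injective (@corners_at M).
Proof.
move=> v v' E; have := some_cornerP v.
have : some_corner v \in corners_at v by rewrite inE some_cornerP.
by rewrite E inE => /eqP -> ->.
Qed.

Lemma perm_iter_crot f k c : {morph f : x / crot x} ->
  f (iter k (@crot M) c) = iter k (@crot M) (f c).
Proof. by move=> fR; elim: k => //= k <-; rewrite fR. Qed.

Lemma imset_corners_at f c : {morph f : x / crot x} ->
  f @: corners_at (cvert c) = corners_at (cvert (f c)).
Proof.
move=> fR; apply/setP=> x; apply/imsetP/idP => [[y]|].
  rewrite inE => /eqP/esym/same_vertexP[k ->] ->.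
  by rewrite inE perm_iter_crot // cvert_iter_crot.
rewrite inE => /eqP/esym/same_vertexP[k ->].
exists (iter k (@crot M) c); last by rewrite perm_iter_crot.
by rewrite inE cvert_iter_crot.
Qed.

(** The triples are the [crot]-orbits, so commuting with [crot] already forces triples to go to
    triples. *)
Lemma OrMapP f : reflect {morph f : c / crot c} (f \in OrMap M).
Proof.
rewrite inE; apply: (iffP andP) => [[_ /forallP fR] c|fR]; first exact/eqP.
split; last by apply/forallP=> c; rewrite fR.
apply/forallP=> v; apply/existsP; exists (cvert (f (some_corner v))).
by rewrite -imset_corners_at // some_cornerP.
Qed.

Lemma OrMap1 : 1%g \in OrMap M.
Proof. by apply/OrMapP=> c; rewrite !perm1. Qed.

Lemma OrMapM f g : f \in OrMap M -> g \in OrMap M -> (f * g)%g \in OrMap M.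
Proof. by move=> /OrMapP fR /OrMapP gR; apply/OrMapP=> c; rewrite !permM fR gR. Qed.

(** A triple determines its vertex, so the [pick] in [vact] has exactly one candidate and its
    default never occurs. *)
Lemma vact_cvert f c : f \in OrMap M -> vact f (cvert c) = cvert (f c).
Proof.
move/OrMapP=> fR; rewrite /vact; case: pickP => [v|/(_ (cvert (f c)))] /=.
  by rewrite imset_corners_at // => /eqP/corners_at_inj.
by rewrite imset_corners_at // eqxx.
Qed.

Lemma vact_choice f phi v : f \in OrMap M -> corner_choice phi ->
  vact f v = cvert (f (phi v)).
Proof. by move=> fO phiP; rewrite -vact_cvert // phiP. Qed.

Lemma vactM f g v : f \in OrMap M -> g \in OrMap M ->
  vact (f * g)%g v = vact g (vact f v).
Proof.
move=> fO gO; rewrite -(some_cornerP v) (vact_cvert _ _ fO) (vact_cvert _ _ gO).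
by rewrite vact_cvert ?OrMapM // permM.
Qed.

(** If two image corners share a vertex, they differ by a power of [crot], which can be pulled back
    through [f]. *)
Lemma vact_inj f : f \in OrMap M -> injective (vact f).
Proof.
move=> fO v v'; rewrite -(some_cornerP v) -(some_cornerP v') !vact_cvert //.
case/same_vertexP=> k; rewrite -perm_iter_crot; last exact/OrMapP.
by move/perm_inj=> ->; rewrite cvert_iter_crot.
Qed.

(** * Independence of the corner choice and additivity *)

Lemma sh_perm f c c' : f \in OrMap M -> cvert c = cvert c' ->
  sh (f c) (f c') = sh c c'.
Proof.
move/OrMapP=> fR /same_vertexP[k ->].
by rewrite (perm_iter_crot f k c fR) !(sh_iter_crot k).
Qed.

Lemma sh_sum_indep f phi psi : f \in OrMap M ->
  corner_choice phi -> corner_choice psi -> sh_sum phi f = sh_sum psi f.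
Proof.
move=> fO phiP psiP; rewrite /sh_sum.
(* Go from [f (phi v)] through [f (psi v)] and [psi (vact f v)] to [phi (vact f v)]. By equivariance
   the first leg is a term at [v]; the last is the opposite term at [vact f v]. *)
have split_sh v : ((sh (f (phi v)) (phi (vact f v)))%:R =
    (sh (phi v) (psi v))%:R + (sh (f (psi v)) (psi (vact f v)))%:R
      + (sh (psi (vact f v)) (phi (vact f v)))%:R :> 'Z_3)%R.
  have e0 : cvert (phi v) = cvert (psi v) by rewrite phiP psiP.
  have e1 : cvert (f (phi v)) = vact f v by rewrite -vact_choice.
  have e2 : cvert (f (psi v)) = vact f v by rewrite -vact_choice.
  rewrite -(sh_perm _ _ _ fO e0) -!natr_sh_add ?phiP ?psiP ?e1 ?e2 //.
apply: (sum_split_reindex _ _ _ (vact_inj _ fO) _ _ _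
  (fun v => (sh (psi v) (phi v))%:R%R) split_sh) => v.
by rewrite -natr_sh_add ?phiP ?psiP // shcc.
Qed.

Lemma sh_mapE f phi : f \in OrMap M -> corner_choice phi ->
  sh_map f = sh_sum phi f.
Proof. by move=> fO phiP; apply: sh_sum_indep => //; apply: some_cornerP. Qed.

Lemma sh_mapM f g : f \in OrMap M -> g \in OrMap M ->
  sh_map (g * f)%g = (sh_map f + sh_map g)%R.
Proof.
move=> fO gO; have phiP := @some_cornerP M; rewrite /sh_map /sh_sum.
(* The intermediate corner is [f] applied to the chosen corner at [vact g v]: the leg before it is
   the summand of [g] at [v], the leg after it the summand of [f] at [vact g v]. *)
apply: (sum_add_reindex _ _ _ (vact_inj _ gO)) => v.
rewrite vactM // permM.
have e : cvert (g (some_corner v)) = cvert (some_corner (vact g v)).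
  by rewrite phiP -vact_choice.
rewrite [RHS]addrC -(sh_perm _ _ _ fO e) -natr_sh_add //.
  by rewrite -!(vact_cvert f) // e.
by rewrite phiP -vact_choice.
Qed.

Lemma sh_map0 f phi : f \in OrMap M -> corner_choice phi ->
  (forall v, f (phi v) = phi (vact f v)) -> sh_map f = 0%R.
Proof.
move=> fO phiP fphi; rewrite (sh_mapE _ _ fO phiP).
by apply: big1 => v _; rewrite fphi shcc.
Qed.

Lemma sh_map1 : sh_map (1%g : {perm corner M}) = 0%R.
Proof.
apply: (sh_map0 _ _ OrMap1 (@some_cornerP M)) => v.
by rewrite (vact_choice _ _ _ OrMap1 (@some_cornerP M)) !perm1 some_cornerP.
Qed.

(** * An element of [OrMap] with nonzero shift *)

Definition turn_corner (v : vertex M) (c : corner M) :=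
  if cvert c == v then crot c else c.

Lemma turn_corner_inj v : injective (turn_corner v).
Proof.
move=> c c' E; have cv x : cvert (turn_corner v x) = cvert x.
  by rewrite /turn_corner; case: ifP => // _; rewrite cvert_crot.
have := E; rewrite /turn_corner -(cv c) E cv.
by case: ifP => // _ /crot_inj.
Qed.

Definition turn v : {perm corner M} := perm (@turn_corner_inj v).

Lemma turn_OrMap v : turn v \in OrMap M.
Proof.
by apply/OrMapP=> c; rewrite !permE /turn_corner cvert_crot; case: ifP.
Qed.

Lemma sh_map_turn v : sh_map (turn v) = 2%:R%R.
Proof.
have phiP := @some_cornerP M.
have fixv w : vact (turn v) w = w.
  rewrite (vact_choice _ _ _ (turn_OrMap v) phiP) permE /turn_corner.
  by case: ifP => _; rewrite ?cvert_crot phiP.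
rewrite /sh_map /sh_sum (bigD1 v) //= big1 => [|w /negbTE wv].
  rewrite addr0 fixv permE /turn_corner phiP eqxx.
  (* The shift is measured from the turned corner back to the chosen one, hence two steps rather
     than one. *)
  by rewrite -{2}(crot3 (some_corner v)) (sh_iter_crot 2).
by rewrite fixv permE /turn_corner phiP wv shcc.
Qed.

(** * Side movements and the group they generate *)

Lemma sm_OrMap b (F : face M) : (sm b F).1 \in OrMap M.
Proof.
apply/OrMapP=> c; rewrite !permE.
case: (eqVneq (on_vertex F (cvert c)) set0) => [E|/set0Pn[d]].
  by rewrite !sm_corner_off // cvert_crot.
rewrite inE => /andP[/face_eq/esym/(sm_cornerE b)[e1 e2 e3] /vertex_eq dv].
(* [c] is one of the three corners around the origin of [d], and these move in order to those around
   the origin of [bnext b d]. *)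
have : cvert (dcorner d) = cvert c by rewrite dv.
rewrite -(cdartK c) => /vertexP[] ->; rewrite !crot_dcorner ?rot3.
- by rewrite e1 e2 crot_dcorner.
- by rewrite e2 e3 crot_dcorner.
- by rewrite e3 e1 crot_dcorner rot3.
Qed.

(** Away from [F] any corner will do, since the side movement fixes the corners there. *)
Definition face_corner (F : face M) v : corner M :=
  if [pick d in on_vertex F v] is Some d then dcorner d else some_corner v.

Lemma face_corner_dart (d : dart M) : face_corner (fac d) (vtx d) = dcorner d.
Proof. by rewrite /face_corner (@pick_vertex _ _ _ d) // porbit_id. Qed.

Lemma face_cornerP F : corner_choice (face_corner F).
Proof.
move=> v; rewrite /face_corner; case: pickP => [d|_]; last exact: some_cornerP.
by rewrite inE => /andP[_ /vertex_eq ->].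
Qed.

Lemma sh_map_sm b (F : face M) : sh_map (sm b F).1 = 0%R.
Proof.
have fO := sm_OrMap b F; have phiP := face_cornerP F.
apply: (sh_map0 _ _ fO phiP) => v; rewrite (vact_choice _ _ _ fO phiP) permE.
case: (eqVneq (on_vertex F v) set0) => [E|/set0Pn[d]].
  by rewrite sm_corner_off phiP.
rewrite inE => /andP[/face_eq -> /vertex_eq ->].
(* At a vertex of [F], the corner of [F] moves to the corner of [F] at the next vertex, which is
   again the chosen one. *)
have [e _ _] := sm_cornerE b (erefl (fac d)).
by rewrite face_corner_dart e -(fac_next b) face_corner_dart.
Qed.

(** The kernel of the shift, pulled back to pairs; being a group, it contains [Rubik dir] once it
    contains the generators. *)
Definition shift_free : {set {perm corner M} * {perm side_edge M}} :=
  [set f | (f.1 \in OrMap M) && (sh_map f.1 == 0%R)].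

Lemma group_set_shift_free : group_set shift_free.
Proof.
apply/group_setP; split=> [|f g].
  by rewrite inE OrMap1 sh_map1 eqxx.
rewrite inE => /andP[fO /eqP f0]; rewrite inE => /andP[gO /eqP g0].
by rewrite inE OrMapM // sh_mapM // f0 g0 addr0 eqxx.
Qed.

Lemma Rubik_shift_free dir : Rubik dir \subset shift_free.
Proof.
rewrite (gen_subG _ (group group_set_shift_free)).
apply/subsetP=> _ /imsetP[F _ ->].
by rewrite inE sm_OrMap sh_map_sm eqxx.
Qed.

End Shift.

(* [f \o g] is the permutation [(g * f)%g]. *)
Theorem theorem1 (M : cubic_map) :
  [/\ (forall c c' c'' : corner M, cvert c = cvert c' -> cvert c' = cvert c'' ->
         sh c c'' = sh c c' + sh c' c'' %[mod 3]),
      (forall f : {perm corner M}, f \in OrMap M ->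
         forall phi psi : vertex M -> corner M,
           corner_choice phi -> corner_choice psi ->
           sh_sum phi f = sh_sum psi f),
      (forall f g : {perm corner M}, f \in OrMap M -> g \in OrMap M ->
         (g * f)%g \in OrMap M /\
         sh_map (g * f)%g = (sh_map f + sh_map g)%R),
      (exists2 f : {perm corner M}, f \in OrMap M & sh_map f <> 0%R) &
      (forall (dir : face M -> bool) (f : {perm corner M} * {perm side_edge M}),
         f \in Rubik dir -> f.1 \in OrMap M /\ sh_map f.1 = 0%R)].
Proof.
split.
- exact: sh_add.
- by move=> f fO phi psi; apply: sh_sum_indep.
- by move=> f g fO gO; rewrite OrMapM // sh_mapM.
(* The map is nonempty, so there is a vertex to turn. *)
- have /card_gt0P[d _] := dart_gt0 M.
  by exists (turn M (vtx d)); [exact: turn_OrMap | rewrite sh_map_turn].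
- move=> dir f /(subsetP (Rubik_shift_free M dir)).
  by rewrite inE => /andP[fO /eqP].
Qed.
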